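(* Let $X$ be a real topological vector space, $f,h:X\to\mathbb{R}\cup\{+\infty\}$ and $\varepsilon\in\mathbb{R}_+$. Then for every $\bar x\in X$, $$\bar x\in\varepsilon\text{-}\operatorname{argmin}_{h(x)\ge 0}f(x)\quad\Longrightarrow\quad\bar x\in E^w_{(\varepsilon,0)}\big((f,-h),X,\mathbb{R}^2_+\big).$$ Conversely, if $h(\bar x)=0$, then $$\bar x\in E^e_{(\varepsilon,0)}\big((f,-h),X,\mathbb{R}^2_+\big)\quad\Longrightarrow\quad\bar x\in\varepsilon\text{-}\operatorname{argmin}_{h(x)\ge 0}f(x).$$
   Context: For an extended-valued map $F$ into $\mathbb{R}^r\cup\{+\infty\}$, $\operatorname{dom}F=\{x\in X: F(x)\in\mathbb{R}^r\}$, where $+\infty$ is an abstract maximal element with $y\pm(+\infty)=+\infty$ for all $y\in\mathbb{R}^r\cup\{+\infty\}$. The map $(f,-h)=(f,0)-(0,h):X\to\mathbb{R}^2\cup\{+\infty\}$ has domain $\operatorname{dom}f\cap\operatorname{dom}h$ and value $+\infty$ elsewhere. On $\mathbb{R}^2$ write $y<y'$ if $y'-y\in\operatorname{int}\mathbb{R}^2_+$, and $y\lneq y'$ if $y'-y\in\mathbb{R}^2_+\setminus\{0\}$; neither relation holds when the left side is $+\infty$ and the right side is in $\mathbb{R}^2$. For $F:X\to\mathbb{R}^2\cup\{+\infty\}$ and $\epsilon\in\mathbb{R}^2$, $E^w_\epsilon(F,X,\mathbb{R}^2_+)=\{\bar x\in\operatorname{dom}F:\ \forall x\in X,\ F(x)\not<F(\bar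 x)-\epsilon\}$ and $E^e_\epsilon(F,X,\mathbb{R}^2_+)=\{\bar x\in\operatorname{dom}F:\ \forall x\in X,\ F(x)\not\lneq F(\bar x)-\epsilon\}$. For $S\subseteq X$, $\varepsilon\text{-}\operatorname{argmin}_{x\in S}f(x)=\{\bar x\in S\cap\operatorname{dom}f:\ \inf_{x\in S}f(x)\ge f(\bar x)-\varepsilon\}$; the subscript $h(x)\ge 0$ means $S=\{x\in X: h(x)\ge 0\}$.
   Formalization: The constraint h(x) ≥ 0 is read as 0 ≤ h(x) < +∞, so points with h(x) = +∞ are not feasible; if they were feasible the claim would fail (e.g. f = 0, h = +∞ everywhere). *)

(* Defs.v *)
From HB Require Import structures.
From mathcomp Require Import all_boot all_order all_algebra.
From mathcomp Require Import all_classical all_reals all_analysis.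
Import Order.TTheory GRing.Theory Num.Theory.
Import numFieldNormedType.Exports.

Set Implicit Arguments.
Unset Strict Implicit.
Unset Printing Implicit Defensive.

Local Open Scope classical_set_scope.
Local Open Scope ring_scope.

(* V \cup {+oo}.  There is no -oo, and V need not be one-dimensional, so this
   is not [\bar R]. *)
Inductive ext (V : Type) : Type := Fin of V | Infty.
Arguments Infty {V}.

(* y - (+oo) = +oo, as well as (+oo) - y = +oo *)
Definition ext_sub (V : zmodType) (y z : ext V) : ext V :=
  match y, z with
  | Fin u, Fin v => Fin (u - v)
  | _, _ => Infty
  end.

Definition ext_pair (V W : Type) (y : ext V) (z : ext W) : ext (V * W) :=
  match y, z with
  | Fin u, Fin v => Fin (u, v)
  | _, _ => Infty
  end.

(* The value +oo belongs to no subset of V. *)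
Definition ext_in (V : Type) (K : set V) (y : ext V) : Prop :=
  match y with
  | Fin v => K v
  | Infty => False
  end.

Definition edom (X V : Type) (F : X -> ext V) : set X :=
  [set x | exists v, F x = Fin v].

Definition ereal_of_ext (R : realType) (y : ext R) : \bar R :=
  match y with
  | Fin r => r%:E
  | Infty => +oo%E
  end.

Section VectorOrder.
Variables (R : realType) (Y : topologicalLmodType R) (K : set Y).

Definition vlt (y y' : ext Y) : Prop := ext_in (interior K) (ext_sub y' y).

Definition vlneq (y y' : ext Y) : Prop := ext_in (K `\ 0) (ext_sub y' y).

Definition Ew (X : Type) (eps : Y) (F : X -> ext Y) : set X :=
  [set xbar | edom F xbar /\
    forall x, ~ vlt (F x) (ext_sub (F xbar) (Fin eps))].

Definition Ee (X : Type) (eps : Y) (F : X -> ext Y) : set X :=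
  [set xbar | edom F xbar /\
    forall x, ~ vlneq (F x) (ext_sub (F xbar) (Fin eps))].

End VectorOrder.

(* R^o * R^o is R^2 with the product topology; R^o is R seen as a module over
   itself. *)
Definition R2plus (R : realType) : set (R^o * R^o) :=
  [set y | 0 <= y.1 /\ 0 <= y.2].

(* (f, -h) = (f, 0) - (0, h), equal to +oo outside of dom f \cap dom h *)
Definition obj_negconstr (R : realType) (X : Type) (f h : X -> ext R) :
    X -> ext (R^o * R^o) :=
  fun x => ext_sub (ext_pair (f x) (Fin 0)) (ext_pair (Fin 0) (h x)).

Definition eps_argmin (R : realType) (X : Type) (eps : R) (S : set X)
    (f : X -> ext R) : set X :=
  [set xbar | [/\ S xbar, edom f xbar &
    (ereal_of_ext (f xbar) - eps%:E <=
       ereal_inf [set ereal_of_ext (f x) | x in S])%E]].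

(* h(x) >= 0 means h(x) \in R_+, so points where h(x) = +oo are not feasible.
   This is the condition -h(x) <= 0 with -(+oo) = 0 - (+oo) = +oo. *)
Definition nonneg_set (R : realType) (X : Type) (h : X -> ext R) : set X :=
  [set x | ext_in [set r : R | 0 <= r] (h x)].

(* Main.v *)
Require Import Defs.
From HB Require Import structures.
From mathcomp Require Import all_boot all_order all_algebra.
From mathcomp Require Import all_classical all_reals all_analysis.
Import Order.TTheory GRing.Theory Num.Theory.
Import numFieldNormedType.Exports.
Local Open Scope classical_set_scope.
Local Open Scope ring_scope.

(** Both directions are contrapositive. A point [x] that beats [xbar] by [(eps, 0)] in the order of
    the interior has [h x >= h xbar >= 0], so it is feasible, and its [f] value is below
    [f xbar - eps], against approximate minimality. Conversely, when [h xbar = 0], a feasible [x]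
    with [f x < f xbar - eps] gives the difference [(f xbar - eps - f x, h x)], which is a nonzero
    vector of the cone. *)

Lemma interior_R2plus_fst_gt0 (R : realType) (y : R^o * R^o) :
  interior (@R2plus R) y -> 0 < y.1.
Proof.
case: y => a b [[A B]] /= [nA nB] AB.
have [e /= e0 eA] := (iffLR (nbhs_ballP _ _) nA).
(* Sliding left by half the radius stays inside the cone, which forces [a >= e / 2 > 0]. *)
have Aae : A (a - e / 2).
  apply: eA; rewrite /ball /= opprB addrCA subrr addr0.
  by rewrite gtr0_norm ?divr_gt0// ltr_pdivrMr// ltr_pMr// ltr1n.
have [/= ae0 _] : @R2plus R (a - e / 2, b).
  by apply: AB; split => //=; exact: nbhs_singleton nB.
by rewrite subr_ge0 in ae0; apply: lt_le_trans ae0; rewrite divr_gt0.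
Qed.

Theorem lemma1 (R : realType) (X : topologicalLmodType R) (f h : X -> ext R)
    (eps : R) (heps : 0 <= eps) (xbar : X) :
  (eps_argmin eps (nonneg_set h) f xbar ->
     Ew (@R2plus R) (eps, 0) (obj_negconstr f h) xbar) /\
  (h xbar = Fin 0 ->
     Ee (@R2plus R) (eps, 0) (obj_negconstr f h) xbar ->
     eps_argmin eps (nonneg_set h) f xbar).
Proof.
split.
- rewrite /eps_argmin /Ew /vlt /edom /obj_negconstr /=.
  case=> hxbar [fb fbE]; move: hxbar; rewrite /nonneg_set /= fbE.
  case hbE: (h xbar) => [hb|] //= hb0 inf_ge.
  split; first by eexists; reflexivity.
  (* If [f x] or [h x] is infinite, the difference is [Infty], which lies in no set, so no
     domination occurs. *)
  move=> x; case fxE: (f x) => [fx|] //=; case hxE: (h x) => [hx|] //= lt_x.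
  have /= := interior_R2plus_fst_gt0 _ _ lt_x.
  rewrite !subr0 subr_gt0 => fx_lt.
  (* For the constraint the weak inequality [hb <= hx] is enough to make [x] feasible. *)
  have /= [_] := interior_subset lt_x.
  rewrite /= !sub0r subr0 opprK addrC subr_ge0 => hb_le.
  have : (fb%:E - eps%:E <= fx%:E)%E.
    apply: le_trans inf_ge _; apply: ereal_inf_lbound.
    by exists x; rewrite ?fxE//= hxE; exact: le_trans hb_le.
  by rewrite -EFinB lee_fin leNgt fx_lt.
- rewrite /eps_argmin /Ee /vlneq /edom /obj_negconstr /= => hbE.
  rewrite hbE; case fbE: (f xbar) => [fb|] /=; last by case=> -[].
  case=> _ nlneq; split; [by rewrite /nonneg_set /= hbE /= lexx | by exists fb | ].
  apply: le_ereal_inf_tmp => _ [x hx_ge0 <-]; move: hx_ge0 (nlneq x).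
  rewrite /nonneg_set /=; case: (h x) => [hx|] //= hx0.
  (* Feasible points outside the domain of [f] contribute [+oo] to the infimum and so respect the
     bound. *)
  case: (f x) => [fx|] /=; last by rewrite leey.
  move=> nlt; rewrite -EFinB lee_fin leNgt; apply/negP => fx_lt.
  apply: nlt; split.
    by rewrite /R2plus /= !subr0 !sub0r opprK subr_ge0 ltW.
  (* The difference is nonzero already in its first coordinate, by the strict inequality [fx_lt]. *)
  move=> [/eqP]; rewrite !subr0 subr_eq0 => /eqP fxE _.
  by rewrite fxE ltxx in fx_lt.
Qed.
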